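(* Let $L$ be a bounded lattice, $\mathrm{V}$ a join-dense set of elements of $L$, and $\Lambda$ a meet-dense set of elements of $L$. For a set $P$ of pairs of elements of $L$, define $\vartriangleleft$ on $P$ by $(a,b)\vartriangleleft(c,d)$ iff $c\not\le b$. Let $\neg a:=a\to0$. (1) If $\to$ is a preimplication on $L$, then with $P=\{(a,a\to b)\mid a,b\in L\}$ there is a complete embedding of $(L,\to)$ into $(\mathfrak{L}(P,\vartriangleleft),\to_\vartriangleleft)$. Moreover, if $\neg$ is an ultraweak pseudocomplementation, then $\vartriangleleft$ is strongly pseudosymmetric. (2) If $\to$ is a protoimplication on $L$, then with $P=\{(a,a\to b)\mid a,b\in L, a\not\le b\}$ there is a complete embedding of $(L,\to)$ into $(\mathfrak{L}(P,\vartriangleleft),\to_\vartriangleleft)$, and $\vartriangleleft$ is reflexive and satisfies right pre-interpolation. Moreover, if $\neg$ is a weak pseudocomplementation, then $\vartriangleleft$ is strongly pseudosymmetric. (3) If $\to$ is an ultraweak pseudoimplication on $L$, then with $P=\{(a,a\to b)\mid a\in\mathrm{V}, b\in L\}\cup\{(1,1\to b)\mid b\in\Lambda\}$ there is a complete embedding of $(L,\to)$ into $(\mathfrak{L}(P,\vartriangleleft),\to_\vartriangleleft)$, and $\vartriangleleft$ satisfies left pre-interpolation. (4) If $\to$ is a weak pseudoimplication on $L$, then with $P=\{(a,a\to b)\mid a\in\mathrm{V}, b\in L, a\not\le b\}$ there is a complete embedding of $(L,\to)$ into $(\mathfrak{L}(P,\vartriangleleft),\to_\vartriangleleft)$, and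 $\vartriangleleft$ is reflexive and satisfies right and left pre-interpolation. Moreover, if $\neg$ is a pseudocomplementation, then $\vartriangleleft$ is weakly compossible. (5) If $\to$ is a relative pseudocomplementation on $L$, then with $P=\{(a,a\to b)\mid a\in\mathrm{V}, b\in\Lambda, a\not\le b\}$ there is a complete embedding of $(L,\to)$ into $(\mathfrak{L}(P,\vartriangleleft),\to_\vartriangleleft)$, and $\vartriangleleft$ is reflexive and compossible. In each case, if $L$ is complete, then the embedding is an isomorphism.
   Context: Join-dense (meet-dense): every element is a join (meet) of a subset. A preimplication on a bounded lattice $L$ is a binary operation $\to$ with, for all $a,b,c$: $a=1\to a$; $a\to(a\to b)\le a\to b$; if $a\le b$ then $b\to c\le a\to c$; if $a\le b$ then $c\to a\le c\to b$. A protoimplication is a preimplication with $b\to b=1$ and $a\wedge(a\to b)\le b$ for all $a,b$. An ultraweak pseudoimplication (resp. weak pseudoimplication) is a preimplication (resp. protoimplication) with $a\le(a\to b)\to b$ for all $a,b$. A relative pseudocomplementation is a protoimplication with: $a\wedge c\le b$ implies $a\le c\to b$. Unary negations: an ultraweak pseudocomplementation is antitone with $a\le\neg\neg a$ and $\neg1=0$; a weak pseudocomplementation is antitone with $a\wedge\neg a=0$ and $a\le\neg\neg a$; a pseudocomplementation sends $a$ to the maximum of $\{y\mid a\wedge y=0\}$. For a nonempty set $X$ with relation $\vartriangleleft$ (write $y\vartriangleright x$ for $x\vartriangleleft y$): $c_\vartriangleleft(A)=\{x\mid\forall x'\vartriangleleft x\ \exists x''\vartriangleright x':x''\in A\}$;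 $\mathfrak{L}(X,\vartriangleleft)$ is the complete lattice of $c_\vartriangleleft$-fixpoints under inclusion (meets are intersections, joins are $c_\vartriangleleft$ of unions); $A\to_\vartriangleleft B=\{x\mid\forall x'\vartriangleleft x\,(x'\in A\Rightarrow\exists x''\vartriangleright x':x''\in B)\}$. $x$ is absurd if no $y$ satisfies $y\vartriangleleft x$. $x$ pre-refines $y$ if $z\vartriangleleft x\Rightarrow z\vartriangleleft y$ for all $z$; $x$ post-refines $y$ if $x\vartriangleleft z\Rightarrow y\vartriangleleft z$ for all $z$; $x$ refines $y$ if it pre-refines and post-refines $y$. $\vartriangleleft$ is strongly pseudosymmetric if for all $x$ and $y\vartriangleleft x$ there is $z\vartriangleleft y$ with $z$ pre-refining $x$ and $x$ pre-refining $z$; satisfies right (resp. left) pre-interpolation if for all $x$ and $y\vartriangleleft x$ there is $z\vartriangleleft x$ (resp. $z\vartriangleleft y$) that post-refines $y$ and pre-refines $x$; is weakly compossible if for all $x$ and $y\vartriangleleft x$ some non-absurd $z$ pre-refines both $y$ and $x$; is compossible if whenever $x\vartriangleleft y$ there is a non-absurd $w$ that refines $x$ and pre-refines $y$. A complete embedding is an injective map preserving all existing meets and joins and commuting with $\to$. *)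

(* Defs.v *)
From HB Require Import structures.
From mathcomp Require Import all_boot all_order.
From mathcomp Require Import boolp classical_sets.
Set Implicit Arguments.
Unset Strict Implicit.
Unset Printing Implicit Defensive.
Import Order.TTheory.
Local Open Scope classical_set_scope.
Local Open Scope order_scope.

(* [supremums S x] and [infimums S x] say that [x] is the join, respectively
   the meet, of [S]; [S] may be empty. *)
Section Dense.
Context {d : Order.disp_t} {L : porderType d}.

Definition join_dense (V : set L) : Prop :=
  forall x, exists2 S, S `<=` V & supremums S x.

Definition meet_dense (V : set L) : Prop :=
  forall x, exists2 S, S `<=` V & infimums S x.

End Dense.

Definition complete_lattice {d : Order.disp_t} (L : porderType d) : Prop :=
  forall S : set L, (exists x, infimums S x) /\ (exists x, supremums S x).

Section Operations.
Context {d : Order.disp_t} {L : tbLatticeType d}.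
Implicit Types (imp : L -> L -> L) (neg : L -> L).

Definition preimplication imp : Prop :=
  [/\ forall a, a = imp \top a,
      forall a b, imp a (imp a b) <= imp a b,
      forall a b c, a <= b -> imp b c <= imp a c
    & forall a b c, a <= b -> imp c a <= imp c b].

Definition protoimplication imp : Prop :=
  [/\ preimplication imp,
      forall b, imp b b = \top
    & forall a b, Order.meet a (imp a b) <= b].

Definition ultraweak_pseudoimplication imp : Prop :=
  preimplication imp /\ forall a b, a <= imp (imp a b) b.

Definition weak_pseudoimplication imp : Prop :=
  protoimplication imp /\ forall a b, a <= imp (imp a b) b.

Definition relative_pseudocomplementation imp : Prop :=
  protoimplication imp /\
  forall a b c, Order.meet a c <= b -> a <= imp c b.

Definition antitone neg : Prop := forall a b, a <= b -> neg b <= neg a.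

Definition ultraweak_pseudocomplementation neg : Prop :=
  [/\ antitone neg, forall a, a <= neg (neg a) & neg \top = \bot].

Definition weak_pseudocomplementation neg : Prop :=
  [/\ antitone neg,
      forall a, Order.meet a (neg a) = \bot
    & forall a, a <= neg (neg a)].

Definition pseudocomplementation neg : Prop :=
  forall a, Order.meet a (neg a) = \bot /\
    forall y, Order.meet a y = \bot -> y <= neg a.

Definition imp_neg imp : L -> L := fun a => imp a \bot.

End Operations.

(* [R x y] reads "x ◁ y", and hence also "y ▷ x". *)
Section Frames.
Context {X : Type} (R : X -> X -> Prop).
Implicit Types (x y z w : X) (A B : set X).

Definition frame_closure A : set X :=
  [set x | forall x', R x' x -> exists2 x'', R x' x'' & A x''].

Definition frame_imp_set A B : set X :=
  [set x | forall x', R x' x -> A x' -> exists2 x'', R x' x'' & B x''].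

Definition absurd x : Prop := ~ exists y, R y x.

Definition pre_refines x y : Prop := forall z, R z x -> R z y.

Definition post_refines x y : Prop := forall z, R x z -> R y z.

Definition refines x y : Prop := pre_refines x y /\ post_refines x y.

Definition frame_reflexive : Prop := forall x, R x x.

Definition strongly_pseudosymmetric : Prop :=
  forall x y, R y x ->
    exists z, [/\ R z y, pre_refines z x & pre_refines x z].

Definition right_pre_interpolation : Prop :=
  forall x y, R y x ->
    exists z, [/\ R z x, post_refines z y & pre_refines z x].

Definition left_pre_interpolation : Prop :=
  forall x y, R y x ->
    exists z, [/\ R z y, post_refines z y & pre_refines z x].

Definition weakly_compossible : Prop :=
  forall x y, R y x ->
    exists z, [/\ ~ absurd z, pre_refines z y & pre_refines z x].

Definition compossible : Prop :=
  forall x y, R x y ->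
    exists w, [/\ ~ absurd w, refines w x & pre_refines w y].

Lemma frame_closure_incl A : A `<=` frame_closure A.
Proof. by move=> x Ax x' Rx'x; exists x. Qed.

Lemma frame_closureS A B : A `<=` B -> frame_closure A `<=` frame_closure B.
Proof.
by move=> AB x cAx x' /cAx[x'' ? /AB ?]; exists x''.
Qed.

Lemma frame_closureK A : frame_closure (frame_closure A) = frame_closure A.
Proof.
apply/seteqP; split; last exact: frame_closure_incl.
by move=> x ccx x' /ccx[y Rx'y /(_ x' Rx'y)].
Qed.

Lemma frame_imp_setK A B :
  frame_closure (frame_imp_set A B) = frame_imp_set A B.
Proof.
apply/seteqP; split; last exact: frame_closure_incl.
by move=> x cx x' /cx[y Rx'y /(_ x' Rx'y)].
Qed.

(* Fixpoints of [frame_closure]; their order is inherited from [set X], that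
   is, inclusion. *)
Record frame_lattice := FrameLattice {
  frame_set :> set X;
  _ : frame_closure frame_set == frame_set }.

HB.instance Definition _ := [isSub for frame_set].
HB.instance Definition _ := [Choice of frame_lattice by <:].
HB.instance Definition _ :=
  [SubChoice_isSubPOrder of frame_lattice by <: with set_display].

Definition frame_imp (A B : frame_lattice) : frame_lattice :=
  @FrameLattice (frame_imp_set A B) (introT eqP (frame_imp_setK A B)).

Lemma frame_setK (A : frame_lattice) : frame_closure A = A.
Proof. by apply/eqP; case: A. Qed.

Lemma frame_leP (A B : frame_lattice) : reflect (A `<=` B) (A <= B).
Proof. exact: asboolP. Qed.

Lemma frame_meetK (S : set frame_lattice) :
  frame_closure (\bigcap_(A in S) A) = \bigcap_(A in S) A.
Proof.
apply/seteqP; split; last exact: frame_closure_incl.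
move=> x cx A SA; rewrite -frame_setK.
by apply: frame_closureS cx => y; apply.
Qed.

Definition frame_meet (S : set frame_lattice) : frame_lattice :=
  @FrameLattice (\bigcap_(A in S) A) (introT eqP (frame_meetK S)).

Definition frame_join (S : set frame_lattice) : frame_lattice :=
  @FrameLattice (frame_closure (\bigcup_(A in S) A))
    (introT eqP (frame_closureK _)).

Lemma frame_meetP S : infimums S (frame_meet S).
Proof.
split=> [A SA | A lA]; apply/frame_leP => x; first by apply.
by move=> Ax B SB; apply: (elimT (frame_leP _ _) (lA B SB)).
Qed.

Lemma frame_joinP S : supremums S (frame_join S).
Proof.
split=> [A SA | A uA]; apply/frame_leP => x.
  by move=> Ax; apply: frame_closure_incl; exists A.
move=> cx; rewrite -frame_setK; apply: frame_closureS cx => y [B SB].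
exact: (elimT (frame_leP _ _) (uA B SB)).
Qed.

Lemma frame_lattice_complete : complete_lattice frame_lattice.
Proof.
move=> S; split; [exists (frame_meet S) | exists (frame_join S)].
- exact: frame_meetP.
- exact: frame_joinP.
Qed.

End Frames.

Definition complete_embedding {d d' : Order.disp_t} {L : porderType d}
    {L' : porderType d'} (imp : L -> L -> L) (imp' : L' -> L' -> L')
    (f : L -> L') : Prop :=
  [/\ injective f,
      forall S x, infimums S x -> infimums (f @` S) (f x),
      forall S x, supremums S x -> supremums (f @` S) (f x)
    & forall a b, f (imp a b) = imp' (f a) (f b)].

Definition isomorphism {d d' : Order.disp_t} {L : porderType d}
    {L' : porderType d'} (imp : L -> L -> L) (imp' : L' -> L' -> L')
    (f : L -> L') : Prop :=
  complete_embedding imp imp' f /\ bijective f.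

Section PairFrames.
Context {d : Order.disp_t} {L : tbLatticeType d}.
Implicit Types (imp : L -> L -> L) (V M : set L).

(* The carrier is the subtype of pairs belonging to [P]. *)
Definition pair_rel (P : set (L * L)) (x y : P) : Prop :=
  ~~ ((val y).1 <= (val x).2).
Arguments pair_rel : clear implicits.

Definition represents imp (P : set (L * L)) : Prop :=
  exists f : L -> frame_lattice (pair_rel P),
    complete_embedding imp (@frame_imp P (pair_rel P)) f /\
    (complete_lattice L -> isomorphism imp (@frame_imp P (pair_rel P)) f).

Definition pairs_all imp : set (L * L) :=
  [set p | exists a b, p = (a, imp a b)].

Definition pairs_nle imp : set (L * L) :=
  [set p | exists a b, ~~ (a <= b) /\ p = (a, imp a b)].

Definition pairs_join imp V M : set (L * L) :=
  [set p | exists a b, V a /\ p = (a, imp a b)] `|`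
  [set p | exists b, M b /\ p = (\top, imp \top b)].

Definition pairs_join_nle imp V : set (L * L) :=
  [set p | exists a b, [/\ V a, ~~ (a <= b) & p = (a, imp a b)]].

Definition pairs_join_meet_nle imp V M : set (L * L) :=
  [set p | exists a b, [/\ V a, M b, ~~ (a <= b) & p = (a, imp a b)]].

End PairFrames.

Arguments pair_rel {d L} P x y.

(* Main.v *)
(** In each case every pair of [P] is [(a, a → b)], and [P] has two separation
    properties: (i) if [x ≰ y], some pair has first component below [x] and not
    below [y]; (ii) if [c ≰ a → b], some pair has first component [<= a] and
    second component [>= b] and not above [c].  These two suffice for
    [x ↦ {p ∈ P | p.1 <= x}] to be a complete embedding.  Fixpoints of the
    closure contain all pairs whose first component lies below the join of their
    first components, so the embedding is onto when [L] is complete.  The frame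
    conditions also follow, because [z] pre-refines [x] as soon as
    [z.1 <= x.1], and post-refines [y] as soon as [y.2 <= z.2]; the
    interpolation properties are then instances of (ii) with [b := y.2]. *)

Require Import Defs.
From mathcomp Require Import all_boot all_order.
From mathcomp Require Import boolp classical_sets.

Import Order.TTheory.
Local Open Scope classical_set_scope.
Local Open Scope order_scope.

(** * Separation of elements by joins, meets and dense sets *)

Lemma supremums_nle d (T : porderType d) (S : set T) (x y : T) :
  supremums S x -> ~~ (x <= y) -> exists2 s, S s & ~~ (s <= y).
Proof.
move=> [_ lub] nxy; apply: contrapT => nex; case/negP: nxy.
by apply: lub => s Ss; apply: contrapT => /negP nsy; apply: nex; exists s.
Qed.

Lemma infimums_nle d (T : porderType d) (S : set T) (x y : T) :
  infimums S x -> ~~ (y <= x) -> exists2 s, S s & ~~ (y <= s).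
Proof.
move=> [_ glb] nyx; apply: contrapT => nex; case/negP: nyx.
by apply: glb => s Ss; apply: contrapT => /negP nys; apply: nex; exists s.
Qed.

Lemma join_dense_nle d (T : porderType d) (V : set T) (x y : T) :
  join_dense V -> ~~ (x <= y) -> exists v, [/\ V v, v <= x & ~~ (v <= y)].
Proof.
move=> hV nxy; have [S SV supS] := hV x.
have [s Ss nsy] := supremums_nle _ _ _ _ _ supS nxy.
by exists s; split=> //; [exact: SV | exact: supS.1].
Qed.

Lemma meet_dense_nle d (T : porderType d) (M : set T) (x y : T) :
  meet_dense M -> ~~ (y <= x) -> exists m, [/\ M m, x <= m & ~~ (y <= m)].
Proof.
move=> hM nyx; have [S SM infS] := hM x.
have [s Ss nys] := infimums_nle _ _ _ _ _ infS nyx.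
by exists s; split=> //; [exact: SM | exact: infS.1].
Qed.

(** * Arithmetic of implications on a bounded lattice *)

Section Preimplication.
Context {d : Order.disp_t} {L : tbLatticeType d}.
Implicit Types (imp : L -> L -> L) (a b c e : L).

Lemma preimplication_ge imp : preimplication imp ->
  forall a b, b <= imp a b.
Proof. by case=> h1 _ anti _ a b; rewrite {1}[b]h1 anti ?lex1. Qed.

(** Monotonicity and contraction give [a → b ≤ c → b ≤ c → (c → e) ≤ c → e]. *)
Lemma preimplication_cut imp : preimplication imp ->
  forall a b c e, c <= a -> b <= imp c e -> imp a b <= imp c e.
Proof.
case=> _ contr anti mono a b c e ca bce.
by rewrite (le_trans (anti _ _ _ ca)) // (le_trans (mono _ _ c bce)).
Qed.

(** [c ≤ (c → b) → b ≤ a → b]: for fixed [b], the map [x ↦ x → b] is an antitone Galois connection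
    with itself. *)
Lemma ultraweak_swap imp : ultraweak_pseudoimplication imp ->
  forall a b c, a <= imp c b -> c <= imp a b.
Proof.
by move=> [[_ _ anti _] dn] a b c acb; apply: le_trans (dn c b) (anti _ _ _ acb).
Qed.

(** [a ≤ b] would force [a → b ≥ a → a = 1]. Hence a pair found for property (ii) automatically
    meets the side condition on [P]. *)
Lemma protoimplication_nle imp : protoimplication imp ->
  forall a b c, ~~ (c <= imp a b) -> ~~ (a <= b).
Proof.
case=> -[_ _ _ mono] one _ a b c; apply: contra => ab.
by rewrite (le_trans (lex1 c)) // -(one a) mono.
Qed.

Lemma protoimplication_le_self imp : protoimplication imp ->
  forall a b, a <= imp a b -> a <= b.
Proof. by case=> _ _ mp a b aab; rewrite -(meet_l aab) mp. Qed.

Lemma relative_pseudocomplementationP imp :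
  relative_pseudocomplementation imp ->
  forall a b c, (a <= imp c b) = (Order.meet a c <= b).
Proof.
move=> [[_ _ mp] res] a b c; apply/idP/idP; last exact: res.
move=> acb; apply: le_trans (mp c b).
by rewrite lexI leIr (le_trans (leIl _ _)).
Qed.

Lemma relative_pseudocomplementation_weak imp :
  relative_pseudocomplementation imp -> weak_pseudoimplication imp.
Proof.
move=> rpc; split; first exact: rpc.1.
by move=> a b; apply: rpc.2; case: rpc.1.
Qed.

Lemma weak_pseudoimplication_ultraweak imp :
  weak_pseudoimplication imp -> ultraweak_pseudoimplication imp.
Proof. by case=> -[? _ _]; split. Qed.

(** Join-density cannot act on [a] inside [a → b]; swapping turns the hypothesis into [a ≰ c → b],
    where it can, and swapping again moves [v] back. *)
Lemma ultraweak_join_dense_nle imp (V : set L) :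
  ultraweak_pseudoimplication imp -> join_dense V ->
  forall a b c, ~~ (c <= imp a b) ->
  exists v, [/\ V v, v <= a & ~~ (c <= imp v b)].
Proof.
move=> uw hV a b c ncab.
have nacb : ~~ (a <= imp c b) by apply: contra ncab; exact: ultraweak_swap.
have [v [Vv va nv]] := join_dense_nle _ _ _ _ _ hV nacb.
by exists v; split=> //; apply: contra nv; exact: ultraweak_swap.
Qed.

End Preimplication.

(** * The embedding attached to a separating set of pairs *)

Section Representation.
Context {d : Order.disp_t} {L : tbLatticeType d}.
Variables (imp : L -> L -> L) (P : set (L * L)).
Implicit Types (a b c : L).

Definition imp_pairs : Prop := P `<=` pairs_all imp.

Definition separates_join : Prop := forall a b, ~~ (a <= b) ->
  exists p : P, (val p).1 <= a /\ ~~ ((val p).1 <= b).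

Definition separates_imp : Prop := forall a b c, ~~ (c <= imp a b) ->
  exists p : P, [/\ (val p).1 <= a, b <= (val p).2 & ~~ (c <= (val p).2)].

Hypotheses (pre : preimplication imp) (pairsP : imp_pairs).

Lemma imp_pairs_snd (p : P) : exists e, (val p).2 = imp (val p).1 e.
Proof. by have [a [e ->]] := pairsP _ (set_valP p); exists e. Qed.

Definition below a : set P := [set p | (val p).1 <= a].

Section Embedding.
Hypotheses (sepJ : separates_join) (sepI : separates_imp).

Lemma frame_closure_below a :
  frame_closure (pair_rel P) (below a) == below a.
Proof.
apply/eqP/seteqP; split; last exact: frame_closure_incl.
move=> p cp; apply: contrapT => /negP npa.
(* Since [a = 1 → a], property (ii) with antecedent [1] yields some [q ◁ p] with [a ≤ q.2]; no pair
   [r ▷ q] then has [r.1 ≤ a]. *)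
have [|q [_ aq npq]] := sepI \top a (val p).1; first by case: pre => <-.
have [r nrq ra] := cp q npq.
by case/negP: nrq; exact: le_trans ra aq.
Qed.

Definition embed a : frame_lattice (pair_rel P) :=
  FrameLattice (frame_closure_below a).

Lemma embed_le a b : (embed a <= embed b) = (a <= b).
Proof.
apply/idP/idP => [/frame_leP sub | ab].
  apply: contrapT => /negP /sepJ[p [pa /negP npb]].
  exact: npb (sub p pa).
by apply/frame_leP => p /= pa; exact: le_trans pa ab.
Qed.

Lemma embed_inj : injective embed.
Proof. by move=> a b eab; apply: le_anti; rewrite -!embed_le eab lexx. Qed.

Lemma embed_infimums S a : infimums S a -> infimums (embed @` S) (embed a).
Proof.
move=> [lb glb]; split=> [_ [s Ss <-] | A lbA].
  by rewrite embed_le; exact: lb.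
apply/frame_leP => p Ap; apply: glb => s Ss.
by have /frame_leP := lbA _ (imageP embed Ss); exact.
Qed.

Lemma embed_supremums S a : supremums S a -> supremums (embed @` S) (embed a).
Proof.
move=> supS; split=> [_ [s Ss <-] | A ubA].
  by rewrite embed_le; exact: supS.1.
(* As [A] is closed, it suffices that every [q ◁ p] has some [r ▷ q] in [A]. Here [a ≰ q.2] passes
   to some [s] in [S], and (i) finds [r] below [s]. *)
apply/frame_leP => p pa; rewrite -frame_setK => q npq.
have naq : ~~ (a <= (val q).2) by apply: contra npq; exact: le_trans.
have [s Ss /sepJ[r [rs nrq]]] := supremums_nle _ _ _ _ _ supS naq.
exists r => //.
by have /frame_leP := ubA _ (imageP embed Ss); exact.
Qed.

Lemma embed_imp a b : embed (imp a b) = frame_imp (embed a) (embed b).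
Proof.
apply: le_anti; apply/andP; split; apply/frame_leP => p.
- move=> pab q npq qa.
  have nbq : ~~ (b <= (val q).2).
    (* The form [q.2 = q.1 → e] is essential here: with [q.1 ≤ a] and [b ≤ q.2], the cut rule gives
       [a → b ≤ q.2], against [q ◁ p]. *)
    apply: contra npq => bq; apply: (le_trans pab).
    have [e eq] := imp_pairs_snd q.
    by rewrite eq; apply: preimplication_cut; rewrite -?eq.
  by have [r [rb nrq]] := sepJ _ _ nbq; exists r.
(* Property (ii) with [c := p.1] gives [q ◁ p] in [below a] whose second component bounds [b], so no
   [r ▷ q] lies in [below b]. *)
- move=> pimp; apply: contrapT => /negP /sepI[q [qa bq npq]].
  have [r nrq rb] := pimp q npq qa.
  by case/negP: nrq; exact: le_trans rb bq.
Qed.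

Lemma embed_complete_embedding :
  complete_embedding imp (@frame_imp P (pair_rel P)) embed.
Proof.
by split; [exact: embed_inj | exact: embed_infimums | exact: embed_supremums
  | exact: embed_imp].
Qed.

Lemma embed_surj (A : frame_lattice (pair_rel P)) :
  complete_lattice L -> exists a, embed a = A.
Proof.
move=> cL; have [_ [a supA]] := cL [set (val p).1 | p in (A : set P)].
exists a; apply: le_anti; apply/andP; split; apply/frame_leP => p.
- move=> pa; rewrite -frame_setK => q npq.
  have naq : ~~ (a <= (val q).2) by apply: contra npq; exact: le_trans.
  have [_ [r Ar <-] nrq] := supremums_nle _ _ _ _ _ supA naq.
  by exists r.
- by move=> Ap; apply: supA.1; exists p.
Qed.

Lemma separates_represents : represents imp P.
Proof.
exists embed; split=> [|cL]; first exact: embed_complete_embedding.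
split; first exact: embed_complete_embedding.
have [g gK] := choice (fun A => embed_surj A cL).
by exists g => // a; apply: embed_inj; rewrite gK.
Qed.

End Embedding.

(** * Frame conditions on pairs *)

Lemma pair_pre_refines (p q : P) :
  (val p).1 <= (val q).1 -> pre_refines (pair_rel P) p q.
Proof. by move=> pq r; apply: contra; exact: le_trans. Qed.

Lemma pair_post_refines (p q : P) :
  (val q).2 <= (val p).2 -> post_refines (pair_rel P) p q.
Proof. by move=> qp r; apply: contra => /le_trans; apply. Qed.

Lemma pair_reflexive_nonabsurd (p : P) :
  frame_reflexive (pair_rel P) -> ~ absurd (pair_rel P) p.
Proof. by move=> refl; apply; exists p. Qed.

(** [(a, a → b) ◁ (a, a → b)] says [a ≰ a → b]; otherwise modus ponens would give [a ≤ b]. *)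
Lemma protoimplication_reflexive :
  protoimplication imp -> P `<=` pairs_nle imp ->
  frame_reflexive (pair_rel P).
Proof.
move=> proto nleP p; rewrite /pair_rel.
have [a [b [nab ->]]] := nleP _ (set_valP p).
by apply: contra nab; exact: protoimplication_le_self.
Qed.

Lemma separates_right_pre_interpolation :
  protoimplication imp -> separates_imp ->
  right_pre_interpolation (pair_rel P).
Proof.
move=> proto sepI x y xy.
have /sepI[z [zx yz nxz]] : ~~ ((val x).1 <= imp (val x).1 (val y).2).
  by apply: contra xy; exact: protoimplication_le_self.
by exists z; split=> //; [exact: pair_post_refines | exact: pair_pre_refines].
Qed.

Lemma separates_left_pre_interpolation :
  ultraweak_pseudoimplication imp -> separates_imp ->
  left_pre_interpolation (pair_rel P).
Proof.
move=> uw sepI x y xy.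
have /sepI[z [zx yz nxz]] : ~~ ((val y).1 <= imp (val x).1 (val y).2).
  (* Swapping gives [x.1 ≤ y.1 → y.2], and [y.2 = y.1 → e], so contraction yields [x.1 ≤ y.2],
     against [y ◁ x]. *)
  apply: contra xy => /(ultraweak_swap _ uw) /le_trans; apply.
  have [e ye] := imp_pairs_snd y; rewrite ye.
  by case: pre => _ contr _ _; exact: contr.
by exists z; split=> //; [exact: pair_post_refines | exact: pair_pre_refines].
Qed.

(** The interpolant is [(x.1, ¬x.1)]: sharing its first component with [x], it pre-refines [x] and
    conversely. Membership in [P] is asked only for nonzero first components, so that sets of pairs
    restricted by [a ≰ b] qualify. *)
Lemma negation_strongly_pseudosymmetric :
  antitone (imp_neg imp) -> (forall a, a <= imp_neg imp (imp_neg imp a)) ->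
  (forall p, P p -> ~~ (p.1 <= \bot) -> P (p.1, imp_neg imp p.1)) ->
  strongly_pseudosymmetric (pair_rel P).
Proof.
move=> anti dn negP x y xy.
have nx0 : ~~ ((val x).1 <= \bot).
  by apply: contra xy => /le_trans; apply; exact: le0x.
exists (SigSub (mem_set (negP _ (set_valP x) nx0))).
split; [|exact: pair_pre_refines..].
(* [y.1 ≤ ¬x.1] would give [x.1 ≤ ¬¬x.1 ≤ ¬y.1 ≤ y.1 → e = y.2]. *)
apply: contra xy => /anti /(le_trans (dn _)) /le_trans; apply.
have [e ->] := imp_pairs_snd y.
by case: pre => _ _ _ mono; exact/mono/le0x.
Qed.

(** If [y.1 ∧ x.1 = 0], then [x.1 ≤ ¬y.1 ≤ y.2], against [y ◁ x]. So (i) finds a pair with first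
    component below this meet; it pre-refines both and is non-absurd by reflexivity. *)
Lemma pseudocomplementation_weakly_compossible :
  pseudocomplementation (imp_neg imp) -> separates_join ->
  frame_reflexive (pair_rel P) -> weakly_compossible (pair_rel P).
Proof.
move=> pc sepJ refl x y xy.
have /sepJ[z [zxy _]] : ~~ (Order.meet (val y).1 (val x).1 <= \bot).
  apply: contra xy; rewrite lex0 => /eqP /(proj2 (pc _)) /le_trans; apply.
  have [e ->] := imp_pairs_snd y.
  by case: pre => _ _ _ mono; exact/mono/le0x.
move: zxy; rewrite lexI => /andP[zy zx].
by exists z; split; [exact: pair_reflexive_nonabsurd | exact: pair_pre_refines..].
Qed.

End Representation.

(** * Separation properties of the concrete sets of pairs *)

Section Instances.
Context {d : Order.disp_t} {L : tbLatticeType d}.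
Variables (imp : L -> L -> L) (V M : set L).
Hypotheses (hV : join_dense V) (hM : meet_dense M).

Lemma pairs_all_separates_join : separates_join (pairs_all imp).
Proof.
move=> a b nab.
have Pp : pairs_all imp (a, imp a b) by exists a, b.
by exists (SigSub (mem_set Pp)).
Qed.

Lemma pairs_all_separates_imp :
  preimplication imp -> separates_imp imp (pairs_all imp).
Proof.
move=> pre a b c ncab.
have Pp : pairs_all imp (a, imp a b) by exists a, b.
by exists (SigSub (mem_set Pp)); split=> //=; exact: preimplication_ge.
Qed.

Lemma pairs_nle_all : imp_pairs imp (pairs_nle imp).
Proof. by move=> _ [a [b [_ ->]]]; exists a, b. Qed.

Lemma pairs_nle_separates_join : separates_join (pairs_nle imp).
Proof.
move=> a b nab.
have Pp : pairs_nle imp (a, imp a b) by exists a, b.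
by exists (SigSub (mem_set Pp)).
Qed.

Lemma pairs_nle_separates_imp :
  protoimplication imp -> separates_imp imp (pairs_nle imp).
Proof.
move=> proto a b c ncab.
have Pp : pairs_nle imp (a, imp a b).
  by exists a, b; split=> //; apply: protoimplication_nle ncab.
exists (SigSub (mem_set Pp)); split=> //=.
by case: proto => pre _ _; exact: preimplication_ge.
Qed.

Lemma pairs_join_all : imp_pairs imp (pairs_join imp V M).
Proof.
by move=> _ [[a [b [_ ->]]] | [b [_ ->]]]; [exists a, b | exists \top, b].
Qed.

Lemma pairs_join_separates_join : separates_join (pairs_join imp V M).
Proof.
move=> a b nab; have [v [Vv va nvb]] := join_dense_nle _ _ _ _ _ hV nab.
have Pp : pairs_join imp V M (v, imp v b) by left; exists v, b.
by exists (SigSub (mem_set Pp)).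
Qed.

Lemma pairs_join_separates_imp :
  ultraweak_pseudoimplication imp -> separates_imp imp (pairs_join imp V M).
Proof.
move=> uw a b c ncab.
have [v [Vv va ncvb]] := ultraweak_join_dense_nle _ _ uw hV _ _ _ ncab.
have Pp : pairs_join imp V M (v, imp v b) by left; exists v, b.
by exists (SigSub (mem_set Pp)); split=> //=; exact: preimplication_ge uw.1 _ _.
Qed.

Lemma pairs_join_nle_nle : pairs_join_nle imp V `<=` pairs_nle imp.
Proof. by move=> _ [a [b [_ nab ->]]]; exists a, b. Qed.

Lemma pairs_join_nle_separates_join : separates_join (pairs_join_nle imp V).
Proof.
move=> a b nab; have [v [Vv va nvb]] := join_dense_nle _ _ _ _ _ hV nab.
have Pp : pairs_join_nle imp V (v, imp v b) by exists v, b.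
by exists (SigSub (mem_set Pp)).
Qed.

Lemma pairs_join_nle_separates_imp :
  weak_pseudoimplication imp -> separates_imp imp (pairs_join_nle imp V).
Proof.
move=> weak a b c ncab.
have uw := weak_pseudoimplication_ultraweak _ weak.
have [v [Vv va ncvb]] := ultraweak_join_dense_nle _ _ uw hV _ _ _ ncab.
have Pp : pairs_join_nle imp V (v, imp v b).
  by exists v, b; split=> //; apply: protoimplication_nle weak.1 _ _ _ ncvb.
by exists (SigSub (mem_set Pp)); split=> //=; exact: preimplication_ge uw.1 _ _.
Qed.

Lemma pairs_join_meet_nle_nle :
  pairs_join_meet_nle imp V M `<=` pairs_nle imp.
Proof. by move=> _ [a [b [_ _ nab ->]]]; exists a, b. Qed.

Lemma pairs_join_meet_nle_separates_join :
  separates_join (pairs_join_meet_nle imp V M).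
Proof.
move=> a b nab; have [v [Vv va nvb]] := join_dense_nle _ _ _ _ _ hV nab.
(* The second index must come from [M], so [b] is enlarged to some [m] in [M] that still fails to
   bound [v]. *)
have [m [Mm bm nvm]] := meet_dense_nle _ _ _ _ _ hM nvb.
have Pp : pairs_join_meet_nle imp V M (v, imp v m) by exists v, m.
by exists (SigSub (mem_set Pp)).
Qed.

Lemma pairs_join_meet_nle_separates_imp :
  relative_pseudocomplementation imp ->
  separates_imp imp (pairs_join_meet_nle imp V M).
Proof.
move=> rpc a b c ncab.
have weak := relative_pseudocomplementation_weak _ rpc.
have uw := weak_pseudoimplication_ultraweak _ weak.
have [v [Vv va]] := ultraweak_join_dense_nle _ _ uw hV _ _ _ ncab.
(* Residuation exposes [b] in [c ∧ v ≰ b], where meet-density replaces it by [m ≥ b] in [M]; then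
   [c ≰ v → m], and [b ≤ m ≤ v → m]. *)
rewrite (relative_pseudocomplementationP _ rpc).
move=> /(meet_dense_nle _ _ _ _ _ hM)[m [Mm bm]].
rewrite -(relative_pseudocomplementationP _ rpc) => ncvm.
have Pp : pairs_join_meet_nle imp V M (v, imp v m).
  by exists v, m; split=> //; apply: protoimplication_nle rpc.1 _ _ _ ncvm.
exists (SigSub (mem_set Pp)); split=> //=.
exact: le_trans bm (preimplication_ge _ uw.1 _ _).
Qed.

Lemma pairs_join_meet_nle_compossible :
  relative_pseudocomplementation imp ->
  compossible (pair_rel (pairs_join_meet_nle imp V M)).
Proof.
move=> rpc x y xy.
have [a [b [Va Mb nab ex]]] := set_valP x.
(* Residuation turns [y.1 ≰ a → b] into [y.1 ∧ a ≰ b], and join-density supplies [v] below the meet.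
   The witness [(v, v → b)] keeps the same [b], so it lies in [P], and [a → b ≤ v → b] gives
   post-refinement. *)
move: xy; rewrite /pair_rel ex /= (relative_pseudocomplementationP _ rpc).
move=> /(join_dense_nle _ _ _ _ _ hV)[v [Vv]].
rewrite lexI => /andP[vy va] nvb.
have Pw : pairs_join_meet_nle imp V M (v, imp v b) by exists v, b.
exists (SigSub (mem_set Pw)); split.
- apply: pair_reflexive_nonabsurd.
  exact: protoimplication_reflexive rpc.1 pairs_join_meet_nle_nle.
- split; [apply: pair_pre_refines | apply: pair_post_refines].
    by rewrite ex.
  by rewrite ex /=; case: rpc.1 => -[_ _ anti _] _ _; exact: anti.
- exact: pair_pre_refines.
Qed.

End Instances.

(** * Assembly of the five cases from separation and the frame conditions *)

Theorem theoremB6 (d : Order.disp_t) (L : tbLatticeType d) (V M : set L)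
    (hV : join_dense V) (hM : meet_dense M) (imp : L -> L -> L) :
  (preimplication imp ->
     let P := pairs_all imp in
     represents imp P /\
     (ultraweak_pseudocomplementation (imp_neg imp) ->
        strongly_pseudosymmetric (pair_rel P))) /\
  (protoimplication imp ->
     let P := pairs_nle imp in
     [/\ represents imp P,
         frame_reflexive (pair_rel P),
         right_pre_interpolation (pair_rel P)
       & weak_pseudocomplementation (imp_neg imp) ->
         strongly_pseudosymmetric (pair_rel P)]) /\
  (ultraweak_pseudoimplication imp ->
     let P := pairs_join imp V M in
     represents imp P /\ left_pre_interpolation (pair_rel P)) /\
  (weak_pseudoimplication imp ->
     let P := pairs_join_nle imp V in
     [/\ represents imp P,
         frame_reflexive (pair_rel P),
         right_pre_interpolation (pair_rel P),
         left_pre_interpolation (pair_rel P)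
       & pseudocomplementation (imp_neg imp) ->
         weakly_compossible (pair_rel P)]) /\
  (relative_pseudocomplementation imp ->
     let P := pairs_join_meet_nle imp V M in
     [/\ represents imp P,
         frame_reflexive (pair_rel P)
       & compossible (pair_rel P)]).
Proof.
split; last split; last split; last split.
- move=> pre P; have pairsP : imp_pairs imp P by [].
  split.
    apply: separates_represents => //; first exact: pairs_all_separates_join.
    exact: pairs_all_separates_imp.
  case=> anti dn _; apply: (negation_strongly_pseudosymmetric imp) => //.
  by move=> p _ _; exists p.1, \bot.
- move=> proto P; have [pre _ _] := proto.
  have sepI := pairs_nle_separates_imp imp proto.
  have pairsP := pairs_nle_all imp.
  split.
  + by apply: separates_represents => //; exact: pairs_nle_separates_join.
  + by apply: protoimplication_reflexive proto _.
  + exact: separates_right_pre_interpolation sepI.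
  + case=> anti _ dn; apply: (negation_strongly_pseudosymmetric imp) => //.
    (* The pair [(p.1, ¬p.1)] arises from [b := 0], for which the side condition [a ≰ b] reads
       [p.1 ≰ 0]. *)
    by move=> p _ np0; exists p.1, \bot.
- move=> uw P; have [pre _] := uw.
  have sepI := pairs_join_separates_imp imp V M hV uw.
  have pairsP := pairs_join_all imp V M.
  split; last exact: separates_left_pre_interpolation sepI.
  by apply: separates_represents => //; exact: pairs_join_separates_join.
- move=> weak P; have [proto _] := weak; have [pre _ _] := proto.
  have uw := weak_pseudoimplication_ultraweak _ weak.
  have sepI := pairs_join_nle_separates_imp imp V hV weak.
  have sepJ := pairs_join_nle_separates_join imp V hV.
  have nleP := pairs_join_nle_nle imp V.
  have pairsP := subset_trans nleP (pairs_nle_all imp).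
  have refl := protoimplication_reflexive _ _ proto nleP.
  split=> //.
  + exact: separates_represents.
  + exact: separates_right_pre_interpolation sepI.
  + exact: separates_left_pre_interpolation sepI.
  + by move=> pc; apply: (pseudocomplementation_weakly_compossible imp).
- move=> rpc P; have [proto _] := rpc; have [pre _ _] := proto.
  have nleP := pairs_join_meet_nle_nle imp V M.
  split.
  + apply: separates_represents => //.
    * exact: subset_trans nleP (pairs_nle_all imp).
    * exact: pairs_join_meet_nle_separates_join.
    * exact: pairs_join_meet_nle_separates_imp.
  + exact: protoimplication_reflexive proto nleP.
  + exact: pairs_join_meet_nle_compossible.
Qed.
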